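(* Let $R\subseteq S$ be an integral extension of domains such that the corresponding extension $K\subseteq L$ of fraction fields is finite, and assume that $R$ is integrally closed. If $\mathrm{Spec}(R)$ is the union of finitely many chains, then the same is true for $\mathrm{Spec}(S)$.
   Context: Rings are commutative with $1$. A chain in $\mathrm{Spec}(R)$ is a subset totally ordered with respect to inclusion. *)

(* Defs.v *)
From HB Require Import structures.
From mathcomp Require Import all_boot all_order all_algebra.
From mathcomp Require Import boolp classical_sets.

Set Implicit Arguments.
Unset Strict Implicit.
Unset Printing Implicit Defensive.

Import GRing.Theory.
Local Open Scope ring_scope.
Local Open Scope classical_set_scope.
Local Open Scope quotient_scope.

Local Notation "x %:F" := (FracField.tofrac x).

Definition Spec (R : comNzRingType) : set (set R) :=
  [set P | idealr_closed [in P] /\ prime_idealr_closed [in P]].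

Definition is_chain (R : comNzRingType) (C : set (set R)) : Prop :=
  C `<=` @Spec R /\ total_on C subset.

Definition Spec_finite_union_of_chains (R : comNzRingType) : Prop :=
  exists (n : nat) (C : 'I_n -> set (set R)),
    (forall i, is_chain (C i)) /\ @Spec R = \bigcup_(i : 'I_n) C i.

Definition integrally_closed (R : idomainType) : Prop :=
  forall x : {fraction R},
    integralOver (@FracField.tofrac R) x -> exists r : R, x = r%:F.

(* n / d |-> f n / f d on a chosen representative n / d; for injective f this
   does not depend on the representative (frac_map_div), and frac_map f is
   then the unique ring morphism extending f to the fraction fields. *)
Definition frac_map (R S : idomainType) (f : {rmorphism R -> S})
    (x : {fraction R}) : {fraction S} :=
  (f \n_(repr x))%:F / (f \d_(repr x))%:F.

Definition frac_finite (R S : idomainType) (f : {rmorphism R -> S}) : Prop :=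
  exists (n : nat) (b : 'I_n -> {fraction S}),
    forall y : {fraction S}, exists c : 'I_n -> {fraction R},
      y = \sum_(i < n) frac_map f (c i) * b i.

Lemma frac_numdenE (R : idomainType) (x : {fraction R}) :
  x = (\n_(repr x))%:F / (\d_(repr x))%:F.
Proof.
set r := repr x; have d0 : (\d_r)%:F != 0 :> {fraction R}.
  by rewrite tofrac_eq0 denom_ratioP.
apply: (mulIf d0); rewrite divfK // -[x in LHS]reprK -/r.
unlock FracField.tofrac; rewrite -[LHS]FracField.pi_mul.
apply/eqP; rewrite FracField.equivf_def /FracField.mulf.
by rewrite !numden_Ratio ?mulf_neq0 ?oner_neq0 ?denom_ratioP // !mulr1 mulrC.
Qed.

Section FracMap.
Variables (R S : idomainType) (f : {rmorphism R -> S}).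
Hypothesis f_inj : injective f.

Let fF_eq0 (d : R) : ((f d)%:F == 0 :> {fraction S}) = (d == 0).
Proof. by rewrite tofrac_eq0 -(rmorph0 f) (inj_eq f_inj). Qed.

Lemma frac_map_div (n d : R) : d != 0 ->
  frac_map f (n%:F / d%:F) = (f n)%:F / (f d)%:F.
Proof.
move=> d0; rewrite /frac_map; set x := n%:F / d%:F; set r := repr x.
have dF0 : d%:F != 0 :> {fraction R} by rewrite tofrac_eq0.
have r0 : (\d_r)%:F != 0 :> {fraction R} by rewrite tofrac_eq0 denom_ratioP.
apply/eqP; rewrite eqr_div ?fF_eq0 ?denom_ratioP //.
rewrite -!tofracM -!rmorphM tofrac_eq (inj_eq f_inj) -tofrac_eq !tofracM.
by rewrite -eqr_div // -frac_numdenE.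
Qed.

Lemma frac_map_tofrac (a : R) : frac_map f a%:F = (f a)%:F.
Proof.
have := frac_map_div a (oner_neq0 R).
by rewrite !rmorph1 !divr1.
Qed.

Lemma frac_map_is_zmod_morphism : zmod_morphism (frac_map f).
Proof.
move=> x y; rewrite (frac_numdenE x) (frac_numdenE y).
set a := \n_(repr x); set b := \d_(repr x).
set c := \n_(repr y); set d := \d_(repr y).
have [b0 d0] : b != 0 /\ d != 0 by rewrite !denom_ratioP.
have -> : a%:F / b%:F - c%:F / d%:F = (a * d - c * b)%:F / (b * d)%:F
    :> {fraction R}.
  by rewrite -mulNr addf_div ?tofrac_eq0 // mulNr -!tofracM -tofracB.
rewrite !frac_map_div ?mulf_neq0 // rmorphB !rmorphM tofracB !tofracM.
by rewrite -[in RHS]mulNr addf_div ?fF_eq0 // mulNr.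
Qed.

Lemma frac_map_is_monoid_morphism : monoid_morphism (frac_map f).
Proof.
split=> [|x y]; first by rewrite -tofrac1 frac_map_tofrac rmorph1.
rewrite (frac_numdenE x) (frac_numdenE y) mulf_div -!tofracM.
by rewrite !frac_map_div ?mulf_neq0 ?denom_ratioP // mulf_div !rmorphM.
Qed.
End FracMap.

(* Main.v *)
Require Import Defs.
From HB Require Import structures.
From mathcomp Require Import all_boot all_order all_algebra fieldext.
From mathcomp Require Import boolp classical_sets filter.

(* Let K and L be the fraction fields of R and S. Multiplication makes L act
   on K^m; over a field E where the minimal polynomials of the matrices of a
   spanning family split, the common eigenvectors of these commuting
   matrices yield finitely many K-embeddings s_i of L into E such that every
   a in L is a root of a monic g over K which factors over E as a product of
   terms X - s_i a. For a in S the coefficients of g are integral over R,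
   hence lie in R, so its constant term is, up to sign, a multiple of a in S
   and a product of conjugates s_i a.
   Let T be the integral closure of R in E. By going up and an ultrafilter
   argument, a chain C of primes of R lifts to a chain D of primes of T. If
   Q is a prime of S over p in C, then Q = s_i^-1 (D p) for some i:
   otherwise prime avoidance and incomparability give a in Q with no
   conjugate in D p, yet the constant term lies in Q and R, hence in p, so
   that the product of conjugates lies in D p. Thus Spec S is covered by the
   chains s_i^-1 (D C). *)

Set Implicit Arguments.
Unset Strict Implicit.
Unset Printing Implicit Defensive.

Import GRing.Theory.
Local Open Scope ring_scope.
Local Open Scope classical_set_scope.

(** * Prime ideals *)

Section Ideals.
Variable R : comNzRingType.
Implicit Types (J P : set R) (a b u v x : R).

Definition lin_closed J := forall a u v, J u -> J v -> J (a * u + v).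

Lemma SpecP P : Spec P <->
  [/\ P 0, ~ P 1, lin_closed P & forall u v, P (u * v) -> P u \/ P v].
Proof.
split=> [[[P0 P1 Plin] Pprime]|[P0 P1 Plin Pprime]].
- split=> [||a u v Pu Pv|u v Puv]; first by rewrite inE in P0.
  + by move=> P1'; move/negP: P1; rewrite inE.
  + by have := Plin a u v; rewrite !inE; apply.
  + by have /orP := Pprime u v (mem_set Puv); rewrite !inE.
- split=> [|u v].
    split=> [||a u v]; rewrite ?inE //; last exact: Plin.
    by apply/negP; rewrite inE.
  by rewrite inE => /Pprime uv; apply/orP; rewrite !inE.
Qed.

Lemma ideal_sum J (I : Type) (r : seq I) (F G : I -> R) : J 0 ->
  lin_closed J -> (forall i, J (F i)) -> J (\sum_(i <- r) G i * F i).
Proof.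
move=> J0 Jlin JF; elim/big_rec: _ => // i x _ Jx.
exact: Jlin.
Qed.

Lemma idealM J a u : J 0 -> lin_closed J -> J u -> J (a * u).
Proof. by move=> J0 Jlin Ju; rewrite -[a * u]addr0; apply: Jlin. Qed.

Lemma idealD J u v : lin_closed J -> J u -> J v -> J (u + v).
Proof. by move=> Jlin Ju Jv; rewrite -[u]mul1r; apply: Jlin. Qed.

Lemma idealN J u : J 0 -> lin_closed J -> J u -> J (- u).
Proof. by move=> J0 Jlin Ju; rewrite -mulN1r; apply: idealM. Qed.

Lemma prime_expr P u n : Spec P -> P (u ^+ n) -> P u.
Proof.
case/SpecP=> P0 P1 Plin Pprime; elim: n => [|n IHn]; first by rewrite expr0.
by rewrite exprS => /Pprime[].
Qed.

Lemma prime_prod P (I : Type) (r : seq I) (F : I -> R) : Spec P ->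
  P (\prod_(i <- r) F i) -> exists i, P (F i).
Proof.
case/SpecP=> P0 P1 Plin Pprime; elim: r => [|i r IHr].
  by rewrite big_nil.
by rewrite big_cons => /Pprime[Pi|/IHr//]; exists i.
Qed.

(* If [a] avoids the [Q i] for [i] in [r] but lies in [Q k], it is corrected by
   an element [y] of [J] outside [Q k] lying in every [Q i] not contained in
   [Q k]. *)
Lemma prime_avoidance (I : eqType) (Q : I -> set R) (r : seq I) J : J 0 ->
  lin_closed J -> (forall i, Spec (Q i)) ->
  (forall i, i \in r -> exists2 x, J x & ~ Q i x) ->
  exists2 x, J x & forall i, i \in r -> ~ Q i x.
Proof.
move=> J0 Jlin Qprime; elim: r => [|k r IHr] avoid; first by exists 0.
have [i ri|a Ja aQ] := IHr; first by apply: avoid; rewrite inE ri orbT.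
have [Qka|nQka] := pselect (Q k a); last first.
  by exists a => // i; rewrite inE => /predU1P[->|/aQ].
have /SpecP[Qk0 Qk1 Qklin Qkprime] := Qprime k.
have [y [Jy nQky yQ]] : exists y, [/\ J y, ~ Q k y &
    forall i, i \in r -> Q i `<=` Q k \/ Q i y].
  elim: r {IHr aQ avoid} (avoid k (mem_head k r)) => [|i r IHr] [x Jx nQkx].
    by exists x; split.
  have [|y [Jy nQky yQ]] := IHr; first by exists x.
  have [ik|/existsNP[b /not_implyP[Qib nQkb]]] := pselect (Q i `<=` Q k).
    by exists y; split=> // j; rewrite inE => /predU1P[->|/yQ]; first left.
  exists (b * y); split=> [||j]; [exact: idealM|by case/Qkprime|].
  have [Qi0 _ Qilin _] := (SpecP _).1 (Qprime i).
  rewrite inE => /predU1P[->|/yQ[]]; [right|by left|right].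
    by rewrite mulrC; apply: idealM.
  have [Qj0 _ Qjlin _] := (SpecP _).1 (Qprime j).
  exact: idealM.
have nQkay : ~ Q k (a + y).
  move=> Qkay; apply: nQky; rewrite -(addKr a y).
  by apply: idealD => //; apply: idealN.
exists (a + y) => [|i]; first exact: idealD.
rewrite inE => /predU1P[-> //|ri Qiay].
have [ik|Qiy] := yQ i ri; first by apply: nQkay; apply: ik.
have [Qi0 _ Qilin _] := (SpecP _).1 (Qprime i).
by apply: (aQ i ri); rewrite -(addrK y a); apply: idealD => //; apply: idealN.
Qed.

End Ideals.

(** * Going up and incomparability for integral ring maps *)

Section GoingUp.
Variables (R T : comNzRingType) (f : {rmorphism R -> T}).
Hypothesis f_integral : integralRange f.

Lemma Spec_preimage (P : set T) : Spec P -> Spec (f @^-1` P).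
Proof.
case/SpecP=> P0 P1 Plin Pprime; apply/SpecP; split=> [||a u v|u v] /=.
- by rewrite rmorph0.
- by rewrite rmorph1.
- by rewrite rmorphD rmorphM; apply: Plin.
- by rewrite rmorphM; apply: Pprime.
Qed.

(** Zorn's lemma gives an ideal [A] maximal among those that contain [J] and contract into [p].
    Maximality makes [A] prime, and integrality forces its contraction to be all of [p]. *)
Lemma going_up (p : set R) (J : set T) : Spec p -> J 0 -> lin_closed J ->
  f @^-1` J `<=` p -> exists P, [/\ Spec P, J `<=` P & f @^-1` P = p].
Proof.
move=> pP; have [p0 p1 plin pprime] := (SpecP p).1 pP => J0 Jlin Jp.
(* The union of the empty family is empty and must be [good] for Zorn's lemma, so [J] is required to
   lie in [X] only when [X] is nonempty. A maximal [A] cannot be empty, since [J] itself is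
   [good]. *)
pose good := [set X : set T |
  [/\ lin_closed X, f @^-1` X `<=` p & X !=set0 -> J `<=` X]].
have [F Fgood Ftot|A [[Alin Ap AJ] Amax]] := @Zorn_bigcup _ good.
  split=> [a u v [X FX Xu] [Y FY Yv]|r [X FX Xr]|[u [X FX Xu]]].
  - have [Z [FZ Zu Zv]] : exists Z, [/\ F Z, Z u & Z v].
      case: (Ftot X Y FX FY) => XY; last by exists X; split=> //; apply: XY.
      by exists Y; split=> //; apply: XY.
    by exists Z => //; have [Zlin _ _] := Fgood Z FZ; apply: Zlin.
  - by have [_ Xp _] := Fgood X FX; apply: Xp.
  - have [_ _ JX] := Fgood X FX.
    by move=> v Jv; exists X => //; apply: JX => //; exists u.
have {AJ}JA : J `<=` A.
  have [/AJ//|A0] := pselect (A !=set0).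
  case: (Amax J); last by split=> // _.
  split=> [u Au|/(_ _ J0)A0']; first by case: A0; exists u.
  by case: A0; exists 0.
have A0 : A 0 by apply: JA.
(* By maximality, the ideal generated by A and x meets the image of R \ p. *)
have meets x : ~ A x -> exists r t, ~ p r /\ A (f r - t * x).
  move=> nAx; apply: contrapT => nex.
  pose B := [set y | exists t, A (y - t * x)].
  have AB : A `<=` B by move=> u Au; exists 0; rewrite mul0r subr0.
  apply: (Amax B).
    by split=> // /(_ x)Bx; apply/nAx/Bx; exists 1; rewrite mul1r subrr.
  split=> [a u v [t Au] [s Av]|r [t Ar]|_]; last exact: subset_trans AB.
    exists (a * t + s); have := Alin a _ _ Au Av.
    by congr A; rewrite mulrBr mulrDl mulrA opprD addrACA.
  by apply: contrapT => npr; apply: nex; exists r, t.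
exists A; split=> //.
  apply/SpecP; split=> // [A1|u v Auv].
    by apply: p1; apply: Ap; rewrite /= rmorph1.
  apply: contrapT => /not_orP[/meets[r [t [npr Ar]]] /meets[s [t' [nps As]]]].
  have : p (r * s); last by case/pprime.
  apply: Ap; rewrite /= rmorphM.
  (* Modulo [A], [f r] is [t * u] and [f s] is [t' * v], so their product is a multiple of [u * v],
     which lies in [A]. *)
  have -> : f r * f s = f s * (f r - t * u)
     + (t * u * (f s - t' * v) + t * t' * (u * v)).
    by rewrite !mulrBr mulrACA subrK mulrC [f s * (t * u)]mulrC subrK.
  by apply/Alin => //; apply/Alin => //; apply: idealM.
apply/seteqP; split=> // x px; apply: contrapT => /meets[r [t [npr Ar]]].
have [q q_monic qt0] := f_integral t; apply: npr.
(* x^n q(t) = 0 is a monic equation for t x; modulo A it is satisfied by r, and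
   its non-leading coefficients lie in p since they are multiples of x. *)
set n := (size q).-1; pose c (i : 'I_n.+1) := q`_i * x ^+ (n - i).
have Ay : A (f (\sum_(i < n.+1) c i * r ^+ i)).
  have Apow i : A (f r ^+ i - (t * f x) ^+ i).
    by rewrite subrXX mulrC; apply: idealM.
  have -> : f (\sum_(i < n.+1) c i * r ^+ i) =
      \sum_(i < n.+1) f (c i) * (f r ^+ i - (t * f x) ^+ i).
    have tx0 : \sum_(i < n.+1) f (c i) * (t * f x) ^+ i = 0 :> T.
      transitivity (f x ^+ n * (map_poly f q).[t]); last first.
        by rewrite (rootP qt0) mulr0.
      rewrite (@horner_coef_wide _ n.+1); last first.
        by rewrite (leq_trans (size_poly _ _)) // leqSpred.
      rewrite mulr_sumr; apply: eq_bigr => i _; rewrite coef_map rmorphM /=.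
      have -> : f x ^+ n = f x ^+ (n - i) * f x ^+ i.
        by rewrite -exprD subnK // -ltnS.
      by rewrite rmorphXn exprMn [f q`_i * _]mulrC [t ^+ i * _]mulrC mulrACA.
    rewrite rmorph_sum /= -[LHS]subr0 -[X in _ - X]tx0 -sumrB.
    by apply: eq_bigr => i _; rewrite rmorphM rmorphXn mulrBr.
  exact: ideal_sum.
apply: (@prime_expr _ _ _ n pP).
have lead : c ord_max = 1 by rewrite /c subnn mulr1; apply/eqP.
have := Ap _ Ay; rewrite big_ord_recr lead mul1r /= => psum.
rewrite -[r ^+ n](addKr (\sum_(i < n) c (widen_ord (leqnSn n) i) * r ^+ i)).
apply: idealD => //; apply: idealN => //.
rewrite (eq_bigr (fun i : 'I_n => r ^+ i * c (widen_ord (leqnSn n) i))).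
  apply: ideal_sum => // i; rewrite /c /= -subnSK // exprSr mulrA.
  exact: idealM.
by move=> i _; rewrite mulrC.
Qed.

(** Suppose [a] is in [Q] but not in [P], and take a monic [q] over [R] whose value at [a] lies in
    [P]. Write [q = q' * 'X + c]. Then [f c] lies in [Q], hence in [P] because the contractions
    agree, so [P] contains [q'(a) * a] and therefore [q'(a)]. The degree drops until [q] is 1, and
    then 1 lies in [P]. *)
Lemma incomparability (P Q : set T) : Spec P -> Spec Q -> P `<=` Q ->
  f @^-1` P = f @^-1` Q -> P = Q.
Proof.
move=> /SpecP[P0 P1 Plin Pprime] /SpecP[Q0 Q1 Qlin Qprime] PQ fPQ.
apply/seteqP; split=> // a Qa; apply: contrapT => nPa.
have [q q_monic qa0] := f_integral a.
have {qa0} : P (map_poly f q).[a] by rewrite (rootP qa0).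
have [n] := ubnP (size q); elim: n => // n IHn in q q_monic *.
rewrite ltnS => szq Pqa.
have [/eqP/size_poly1P[c c0 qE]|q1] := eqVneq (size q) 1.
  move: Pqa; move: q_monic; rewrite qE monicE lead_coefC => /eqP->.
  by rewrite map_polyC hornerC /= rmorph1.
pose q' := \poly_(i < (size q).-1) q`_i.+1.
pose c := q`_0; have qq' : q = q' * 'X + c%:P.
  apply/polyP => i; rewrite coefD coefMX coefC coef_poly.
  case: i => [|i] /=; first by rewrite add0r.
  rewrite addr0; case: ltnP => // le_i; rewrite nth_default //.
  by case: (size q) le_i.
have q'0 : q' != 0.
  apply: contraNneq q1 => q'0; rewrite qq' q'0 mul0r add0r size_polyC.
  have := monic_neq0 q_monic.
  by rewrite qq' q'0 mul0r add0r polyC_eq0 => ->.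
have szq' : (size q' < n)%N.
  by move: szq; rewrite qq' size_MXaddC (negPf q'0).
have q'_monic : q' \is monic.
  move: q_monic; rewrite !monicE qq' lead_coefDl ?lead_coefMX //.
  by rewrite size_mulX // size_polyC ltnS (leq_trans (leq_b1 _)) //
    lt0n size_poly_eq0.
move: Pqa; rewrite qq' rmorphD rmorphM /= map_polyX map_polyC hornerMXaddC /=.
set y := (map_poly f q').[a] => Pc.
have Qc : Q (f c).
  rewrite -[f c](addKr (y * a)); apply: idealD => //; last exact: PQ.
  by apply: idealN => //; apply: idealM.
have {Qc}Pfc : (f @^-1` P) c by rewrite fPQ.
have /Pprime[Py|//] : P (y * a).
  by rewrite -[y * a](addrK (f c)); apply: idealD => //; apply: idealN.
exact: IHn Py.
Qed.

End GoingUp.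

(** * Lifting chains of primes *)

Section ChainLifting.
Variables (R T : comNzRingType) (f : {rmorphism R -> T}).
Hypothesis f_integral : integralRange f.

(** [D] is a total function constrained only on [A], so that the lifts for various finite lists can
    be compared at one prime. Monotonicity makes the image of a chain a chain. *)
Definition lifts_on (A : set (set R)) (D : set R -> set T) :=
  (forall p, A p -> Spec (D p) /\ f @^-1` D p = p) /\
  (forall p q, A p -> A q -> p `<=` q -> D p `<=` D q).

Let leS (p q : set R) := `[< p `<=` q >].

(** Going up is applied at each prime of the path with [J] the lift of the previous one. That all
    lifts contain [P0] is what carries monotonicity through the induction. *)
Lemma lift_path (p0 : set R) (s : seq (set R)) (P0 : set T) :
  (forall p, p \in s -> Spec p) -> path leS p0 s -> Spec P0 ->
  f @^-1` P0 = p0 ->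
  exists D, lifts_on [set` s] D /\ forall p, p \in s -> P0 `<=` D p.
Proof.
elim: s p0 P0 => [|p s IHs] p0 P0 sP /=.
  by exists (fun=> P0); split=> //; split.
case/andP=> /asboolP p0p ps P0P fP0.
have leS_trans : transitive leS.
  move=> y x z /asboolP xy /asboolP yz; apply/asboolP; exact: subset_trans yz.
have [P00 _ P0lin _] := (SpecP P0).1 P0P.
have [|P [PP P0leP fP]] := going_up f_integral (sP _ (mem_head _ _)) P00 P0lin.
  by rewrite fP0.
have [q sq|D [[Dlift Dmono] PD]] := IHs p P _ ps PP fP.
  by apply: sP; rewrite inE sq orbT.
exists (fun q => if q == p then P else D q); split; last first.
  move=> q; rewrite inE; case: eqP => [-> //|_ /= sq].
  exact/(subset_trans P0leP)/PD.
split=> [q|q q'] /=; rewrite ?inE; first by case: eqP => [->|_ /Dlift].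
case: eqP => [->|nqp] /=; case: eqP => [->|nq'p] //= sq.
- by move=> _ _ x.
- by move=> sq' _; apply: PD.
(* Every [q] later in the path contains [p], so here [q] would equal [p]. *)
- move=> _ qp; case: nqp; apply/seteqP; split=> //.
  by have /allP/(_ q sq)/asboolP := order_path_min leS_trans ps.
- exact: Dmono.
Qed.

(** Sorting by inclusion turns the list into a path. Its least prime is lifted by going up from the
    zero ideal, which contracts to zero as [f] is injective. *)
Lemma lift_finite_chain (s : seq (set R)) : injective f ->
  (forall p, p \in s -> Spec p) -> total_on [set` s] subset ->
  exists D, lifts_on [set` s] D.
Proof.
move=> f_inj sP stot.
pose t := sort leS s.
have ts : t =i s by exact: mem_sort.
have tS : sorted leS t.
  apply: (@sort_sorted_in _ [in s]); last exact/allP.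
  move=> p q ps qs; apply/orP.
  by case: (stot p q ps qs) => pq; [left|right]; apply/asboolP.
have setE : [set` s] = [set` t] by apply/seteqP; split=> p /=; rewrite ts.
rewrite setE.
have {sP}tP p : p \in t -> Spec p by rewrite ts; apply: sP.
case: t tS tP {ts setE} => [|p t] /= pt tP; first by exists (fun=> setT); split.
have pP := tP p (mem_head _ _); have [p0 _ _ _] := (SpecP p).1 pP.
have [||x|P [PP _ fP]] := going_up f_integral (J := [set 0]) pP.
- by [].
- by move=> a u v /= -> ->; rewrite mulr0 addr0.
- by move=> /= fx; have -> : x = 0 by apply: f_inj; rewrite fx rmorph0.
(* The path starts at [p] and visits [p] again, so that [p] too is among the primes receiving a
   lift. *)
have [|D [Dlift _]] := @lift_path p (p :: t) P tP _ PP fP; last by exists D.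
by rewrite /= pt andbT; apply/asboolP.
Qed.

(* Compactness: the lifts of the finite subchains converge along an
   ultrafilter on the finite lists of primes containing every tail. *)
Lemma lift_chain (C : set (set R)) : injective f -> is_chain C ->
  exists D, lifts_on C D.
Proof.
move=> f_inj [CP Ctot].
(* Discarding the members outside [C] makes every list yield a finite chain, so [D l] exists without
   a condition on [l]. *)
pose sub (l : seq (set R)) := [seq p <- l | `[< C p >]].
have subC l p : p \in sub l = `[< C p >] && (p \in l) by rewrite mem_filter.
have /choice[D Dlift] l : exists D, lifts_on [set` sub l] D.
  apply: lift_finite_chain => // [p|p q /=]; rewrite !subC.
    by case/andP=> /asboolP/CP.
  by case/andP=> /asboolP Cp _ /andP[/asboolP Cq _]; apply: Ctot.
pose B (l : seq (set R)) := [set l' : seq (set R) | {subset l <= l'}].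
have BF : Filter (filter_from [set: seq (set R)] B).
  apply: filter_from_filter; first by exists [::].
  move=> l l' _ _; exists (l ++ l') => // m lm.
  by split=> p pl; apply: lm; rewrite mem_cat pl ?orbT.
have BPF : ProperFilter (filter_from [set: seq (set R)] B).
  by apply: filter_from_proper => l _; exists l.
have [U [UU BU]] := ultraFilterLemma BPF.
have Ulist p : C p -> U [set l | p \in sub l].
  move=> Cp; apply: BU; exists [:: p] => // l /(_ p (mem_head _ _)) pl /=.
  by rewrite subC pl andbT; apply/asboolP.
have UW p (X Y : set (seq (set R))) : C p ->
    (forall l, p \in sub l -> X l -> Y l) -> U X -> U Y.
  move=> Cp XY UX; apply: filterS (filterI (Ulist p Cp) UX) => l [].
  exact: XY.
have Ucst p (A : Prop) : C p -> U [set _ | A] -> A.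
  by move=> Cp /filter_ex[].
(* The limit prime consists of the [t] that lie in [D l p] for [U]-almost every [l]. Each clause is
   checked on the lists containing the relevant primes. Primality uses that [U] contains a set or
   its complement. *)
exists (fun p => [set t | U [set l | D l p t]]).
split=> [p Cp|p q Cp Cq pq t /=].
  split; last first.
    apply/seteqP; split=> x /=.
      move=> UDx; apply: (Ucst p) => //; apply: (UW p _ _ Cp) UDx => l pl /=.
      by have [/(_ p pl)[_ {2}<-] _] := Dlift l.
    move=> px; apply: (UW p _ _ Cp) (Ulist p Cp) => l pl _ /=.
    by have [/(_ p pl)[_ fD] _] := Dlift l; rewrite -fD in px.
  have DP l : p \in sub l -> [/\ D l p 0, ~ D l p 1, lin_closed (D l p) &
      forall u v, D l p (u * v) -> D l p u \/ D l p v].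
    by move=> pl; apply/SpecP; have [/(_ p pl)[]] := Dlift l.
  apply/SpecP; split=> [||a u v Uu Uv|u v Uuv] /=.
  - by apply: (UW p _ _ Cp) (Ulist p Cp) => l /DP[].
  - by move=> U1; apply: (Ucst p) => //; apply: (UW p _ _ Cp) U1 => l /DP[].
  - apply: (UW p _ _ Cp) (filterI Uu Uv) => l /DP[_ _ Dlin _] [].
    exact: Dlin.
  - have [|nUu] := in_ultra_setVsetC [set l | D l p u] UU; first by left.
    right; apply: (UW p _ _ Cp) (filterI Uuv nUu) => l /DP[_ _ _ Dprime].
    by case=> /Dprime[].
move=> Ut; apply: (UW p _ _ Cp) (filterI (Ulist q Cq) Ut) => l pl [ql].
by have [_ Dmono] := Dlift l; apply: Dmono.
Qed.

End ChainLifting.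

(** * Splitting fields and common eigenvectors *)

Lemma irreducible_factor (F : fieldType) (p : {poly F}) : (1 < size p)%N ->
  exists2 q, irreducible_poly q & (q %| p)%R.
Proof.
have [n] := ubnP (size p); elim: n p => // n IHn p /ltnSE szp p_gt1.
have [irr_p|] := pselect (irreducible_poly p); first by exists p.
have p0 : p != 0 by rewrite -size_poly_gt0 ltnW.
move=> nirr; have [q [szq qp nqp]] : exists q : {poly F}, [/\ size q != 1%N,
    (q %| p)%R & ~~ (q %= p)%R].
  apply: contrapT => nex; apply: nirr; split=> // q szq qp.
  by apply/negPn/negP => nqp; apply: nex; exists q.
have q0 : q != 0 by apply: contraTneq qp => ->; rewrite dvd0p.
have ltqp : (size q < size p)%N.
  by rewrite ltn_neqAle dvdp_leq // andbT (dvdp_size_eqp qp).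
have [||r irr_r rq] := IHn q.
- exact: leq_trans szp.
- by rewrite ltn_neqAle eq_sym szq size_poly_gt0.
- by exists r => //; apply: dvdp_trans qp.
Qed.

(** Adjoin a root [z] of an irreducible factor, divide by ['X - z%:P], and repeat over the larger
    field. *)
Lemma splitting_extension (F : fieldType) (p : {poly F}) : p \is monic ->
  exists (E : fieldType) (j : {rmorphism F -> E}) (rs : seq E),
    map_poly j p = \prod_(z <- rs) ('X - z%:P).
Proof.
have [n] := ubnP (size p); elim: n F p => // n IHn F p /ltnSE szp p_monic.
have [sz1|sz_gt1] := leqP (size p) 1.
  exists F, idfun, [::]; rewrite big_nil map_poly_id //.
  move: p_monic; rewrite monicE (size1_polyC sz1) lead_coefC.
  by move/eqP->.
have [q irr_q qp] := irreducible_factor sz_gt1.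
have [L _ [z qz _]] := irredp_FAdjoin irr_q.
have /factor_theorem[p' pE] : root (map_poly (in_alg L) p) z.
  by have [r ->] := dvdpP _ _ qp; rewrite rmorphM rootM qz orbT.
have p'_monic : p' \is monic.
  have := p_monic; rewrite -(map_monic (in_alg L)) pE.
  by rewrite monicMr ?monicXsubC.
have [|E [j [rs p'E]]] := IHn L p' _ p'_monic.
  rewrite (leq_trans _ szp) // -(size_map_poly (in_alg L)) pE.
  by rewrite size_Mmonic ?monicXsubC ?monic_neq0 // size_XsubC addn2.
exists E, (j \o in_alg L), (j z :: rs).
by rewrite map_poly_comp pE rmorphM /= p'E map_polyXsubC big_cons mulrC.
Qed.

(** * The regular representation of a finite field extension *)

Section RegularRepresentation.
Variables (K L : fieldType) (phi : {rmorphism K -> L}).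

Definition spanned n (b : 'I_n -> L) :=
  forall y, exists c : 'I_n -> K, y = \sum_(i < n) phi (c i) * b i.

Lemma spanned_basis n (b : 'I_n -> L) : spanned b ->
  exists m (e : 'I_m -> L), spanned e /\
    forall c : 'I_m -> K, \sum_(i < m) phi (c i) * e i = 0 ->
      forall i, c i = 0.
Proof.
elim: n b => [|n IHn] b bspan; first by exists 0, b; split=> // c _ [].
have [free|] := pselect (forall c : 'I_n.+1 -> K,
  \sum_(i < n.+1) phi (c i) * b i = 0 -> forall i, c i = 0).
  by exists n.+1, b.
move=> /existsNP[c /not_implyP[cb0 /existsNP[k /eqP ck0]]].
apply: (IHn (b \o lift k)) => y; have [d ->] := bspan y.
(* Subtracting [d k / c k] times the relation [c] cancels the coefficient of the redundant generator
   [b k]. *)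
exists (fun i => d (lift k i) - d k / c k * c (lift k i)).
have phick0 : phi (c k) != 0 by rewrite fmorph_eq0.
transitivity (\sum_(i < n.+1) phi (d i) * b i -
    phi (d k / c k) * \sum_(i < n.+1) phi (c i) * b i).
  by rewrite cb0 mulr0 subr0.
rewrite mulr_sumr -sumrB (bigD1_ord k) //= !rmorphM fmorphV mulrA divfK //.
rewrite subrr add0r.
apply: eq_bigr => i _.
by rewrite rmorphB !rmorphM fmorphV mulrA mulrBl.
Qed.

(** On a basis, written as a column [ecol], the matrix [M a] is the only one over [K] with
    [M a *m ecol = a *: ecol]. This uniqueness gives every morphism law. The basis is nonempty
    because 1 is nonzero in [L], hence the size [m.+1]. *)
Lemma regular_representation n (b : 'I_n -> L) : spanned b ->
  exists m (M : {rmorphism L -> 'M[K]_m.+1}), forall k, M (phi k) = k%:M.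
Proof.
case/spanned_basis=> [[|m] [e [espan efree]]].
  have [c] := espan 1; rewrite big_ord0 => /eqP; by rewrite oner_eq0.
have /choice[coord coordE] := espan.
pose ecol : 'cV[L]_m.+1 := \col_i e i.
pose M a : 'M[K]_m.+1 := \matrix_(i, j) coord (a * e i) j.
have ME a : map_mx phi (M a) *m ecol = a *: ecol.
  apply/colP => i; rewrite !mxE [RHS]coordE; apply: eq_bigr => j _.
  by rewrite !mxE.
have Minj (A B : 'M[K]_m.+1) :
    map_mx phi A *m ecol = map_mx phi B *m ecol -> A = B.
  move=> AB; apply/matrixP => i j; apply/eqP; rewrite -subr_eq0; apply/eqP.
  apply: (efree (fun j => A i j - B i j)).
  move/colP/(_ i): AB; rewrite !mxE => /eqP; rewrite -subr_eq0 -sumrB => /eqP.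
  move=> AB0; rewrite -[RHS]AB0; apply: eq_bigr => l _.
  by rewrite !mxE rmorphB mulrBl.
have Mphi k : M (phi k) = k%:M.
  by apply: Minj; rewrite ME map_scalar_mx mul_scalar_mx.
have Madd : zmod_morphism M.
  by move=> x y; apply: Minj; rewrite map_mxB mulmxBl !ME scalerBl.
have Mmul : monoid_morphism M.
  split=> [|x y]; first by rewrite -(rmorph1 phi) Mphi.
  by apply: Minj; rewrite map_mxM -mulmxA !ME -scalemxAr ME scalerA mulrC.
pose Ma := GRing.isZmodMorphism.Build _ _ M Madd.
pose Mm := GRing.isMonoidMorphism.Build _ _ M Mmul.
pose MR : {rmorphism L -> 'M[K]_m.+1} := HB.pack M Ma Mm.
by exists m, MR.
Qed.

End RegularRepresentation.

Section CommonEigenvector.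
Variables (E : fieldType) (m : nat) (L : eqType) (N : L -> 'M[E]_m.+1).
Hypothesis N_comm : forall a b, N a *m N b = N b *m N a.
Implicit Types v w : 'rV[E]_m.+1.

(** Multiply [v] by the factors one at a time: the last nonzero product is an eigenvector of [N b].
    It inherits every eigenvalue of [v], since the matrices commute. *)
Lemma eigenvector_of_split v b (zs : seq E) : v != 0 ->
  v *m \prod_(z <- zs) (N b - z%:M) = 0 ->
  exists w, [/\ w != 0, exists z, w *m N b = z *: w &
    forall a y, v *m N a = y *: v -> w *m N a = y *: w].
Proof.
elim: zs v => [|z zs IHzs] v v0.
  by rewrite big_nil mulmx1 => v0'; rewrite v0' eqxx in v0.
rewrite big_cons mulmxA; have [vz _|vz] := eqVneq (v *m (N b - z%:M)) 0.
  exists v; split=> //; exists z; apply/eqP.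
  by rewrite -subr_eq0 -mul_mx_scalar -mulmxBr vz.
move=> /(IHzs _ vz)[w [w0 wb wv]]; exists w; split=> // a y va.
apply: wv; rewrite -mulmxA mulmxBl N_comm -scalar_mxC -mulmxBr mulmxA va.
by rewrite scalemxAl.
Qed.

Lemma common_eigenvector_of_split v (bs : seq L) : v != 0 ->
  (forall b, b \in bs ->
    exists zs : seq E, \prod_(z <- zs) (N b - z%:M) = 0) ->
  exists w, [/\ w != 0, forall b, b \in bs -> exists z, w *m N b = z *: w &
    forall a y, v *m N a = y *: v -> w *m N a = y *: w].
Proof.
elim: bs v => [|b bs IHbs] v v0 split_bs; first by exists v; split.
have [zs zs0] := split_bs b (mem_head b bs).
have [|u [u0 [z ub] uv]] := @eigenvector_of_split v b zs v0.
  by rewrite zs0 mulmx0.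
have [|w [w0 wbs wu]] := IHbs u u0.
  by move=> c cbs; apply: split_bs; rewrite inE cbs orbT.
exists w; split=> // [c|a y /uv/wu//].
by rewrite inE => /predU1P[->|/wbs//]; exists z; apply: wu.
Qed.

End CommonEigenvector.

(** * Finitely many embeddings, read off common eigenvectors *)

Section Embeddings.
Variables (K L : fieldType) (phi : {rmorphism K -> L}).

Section Eigenvalues.
Variables (n : nat) (b : 'I_n -> L).
Hypothesis b_span : spanned phi b.
Variables (m : nat) (M : {rmorphism L -> 'M[K]_m.+1}).
Hypothesis M_phi : forall k, M (phi k) = k%:M.

Lemma horner_representation a (p : {poly K}) :
  horner_mx (M a) p = M (map_poly phi p).[a].
Proof.
elim/poly_ind: p => [|p c IHp]; first by rewrite !rmorph0 horner0 rmorph0.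
rewrite !rmorphD !rmorphM /= horner_mx_X horner_mx_C IHp map_polyX map_polyC.
by rewrite hornerMXaddC rmorphD rmorphM M_phi.
Qed.

(** On a common eigenvector [w], the map from [c] to the eigenvalue of [M c] is a ring morphism.
    Starting from an eigenvector of [M a] for [y] makes it send [a] to [y]. *)
Lemma embedding_of_root (E : fieldType) (j : {rmorphism K -> E}) (rs : seq E)
    (a : L) (y : E) :
  (forall i, (map_poly j (mxminpoly (M (b i))) %|
    \prod_(z <- rs) ('X - z%:P))%R) ->
  root (map_poly j (mxminpoly (M a))) y ->
  exists s : {rmorphism L -> E}, [/\ forall k, s (phi k) = j k, s a = y &
    forall c, root (map_poly j (mxminpoly (M c))) (s c)].
Proof.
move=> b_split; pose N c := map_mx j (M c).
have eigN c z : root (map_poly j (mxminpoly (M c))) z = eigenvalue (N c) z.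
  by rewrite eigenvalue_root_min mxminpoly_map.
rewrite eigN => /eigenvalueP[v va v0].
have N_comm c d : N c *m N d = N d *m N c.
  by rewrite -!map_mxM !mulmxE -!rmorphM mulrC.
have [_ /codomP[i ->]|w [w0 wb wv]] :=
    common_eigenvector_of_split N_comm (bs := codom b) v0.
  exists rs; transitivity (horner_mx (N (b i)) (\prod_(z <- rs) ('X - z%:P))).
    rewrite rmorph_prod; apply: eq_bigr => z _.
    by rewrite rmorphB /= horner_mx_X horner_mx_C.
  have [q ->] := dvdpP _ _ (b_split i).
  by rewrite rmorphM /= -map_horner_mx mx_root_minpoly map_mx0 mulr0.
(* The [b i] span [L] over [K], and [K] acts by scalars, so [w] is an eigenvector of every [N c]. *)
have /choice[s sE] c : exists z, w *m N c = z *: w.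
  have [k ->] := b_span c.
  have /choice[z zE] i : exists z, w *m N (b i) = z *: w.
    by apply: wb; apply: codom_f.
  exists (\sum_i j (k i) * z i); rewrite /N rmorph_sum map_mx_sum mulmx_sumr.
  rewrite scaler_suml; apply: eq_bigr => i _.
  rewrite rmorphM M_phi map_mxM mulmxA map_scalar_mx mul_mx_scalar -scalemxAl.
  by rewrite zE scalerA.
have w_inj x z : x *: w = z *: w -> x = z.
  move/eqP; rewrite -subr_eq0 -scalerBl scaler_eq0 (negPf w0) orbF subr_eq0.
  by move/eqP.
have s_phi k : s (phi k) = j k.
  by apply: w_inj; rewrite -sE /N M_phi map_scalar_mx mul_mx_scalar.
have sB : zmod_morphism s.
  move=> x z; apply: w_inj.
  by rewrite scalerBl -!sE /N rmorphB map_mxB mulmxBr.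
have sM : monoid_morphism s.
  split=> [|x z]; first by rewrite -(rmorph1 phi) s_phi rmorph1.
  apply: w_inj; rewrite -sE /N rmorphM map_mxM mulmxA sE -scalemxAl sE scalerA.
  by [].
pose sBm := GRing.isZmodMorphism.Build _ _ s sB.
pose sMm := GRing.isMonoidMorphism.Build _ _ s sM.
pose sR : {rmorphism L -> E} := HB.pack s sBm sMm.
exists sR; split=> //= [|c].
  by apply: w_inj; rewrite -sE; apply: wv.
by rewrite eigN; apply/eigenvalueP; exists w.
Qed.

End Eigenvalues.

Lemma factor_through_extension (E E' : fieldType) (h : {rmorphism E -> E'})
    (s' : {rmorphism L -> E'}) : (forall c, exists z, s' c = h z) ->
  exists s : {rmorphism L -> E}, forall c, s' c = h (s c).
Proof.
move=> /choice[s sE].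
have sB : zmod_morphism s.
  by move=> x z; apply: (fmorph_inj h); rewrite rmorphB -!sE rmorphB.
have sM : monoid_morphism s.
  split=> [|x z]; apply: (fmorph_inj h); first by rewrite -sE !rmorph1.
  by rewrite rmorphM -!sE rmorphM.
pose sBm := GRing.isZmodMorphism.Build _ _ s sB.
pose sMm := GRing.isMonoidMorphism.Build _ _ s sM.
pose sR : {rmorphism L -> E} := HB.pack s sBm sMm.
by exists sR.
Qed.

(** Pick one element for each attained tag in [F]. For embeddings the tag records the images of the
    spanning family, which determine the embedding. *)
Lemma finite_representatives (X : Type) (F : finType) (P : X -> F -> Prop) :
  (forall x, exists t, P x t) ->
  exists N (s : 'I_N -> X), forall x, exists k t, P x t /\ P (s k) t.
Proof.
move=> Ptot; pose A := [set t | `[< exists x, P x t >]]%SET.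
have /choice[s sP] (k : 'I_#|A|) : exists x, P x (enum_val k).
  by have := enum_valP k; rewrite finset.inE => /asboolP.
exists #|A|, s => x; have [t Pxt] := Ptot x.
have At : t \in A by rewrite finset.inE; apply/asboolP; exists x.
exists (enum_rank_in At t), t; split=> //.
by have := sP (enum_rank_in At t); rewrite enum_rankK_in.
Qed.

(* The Galois orbit of [a] appears here as the list of its images under the
   finitely many embeddings of [L] into [E], where [L] need not be normal. *)
Lemma finite_embeddings n (b : 'I_n -> L) : spanned phi b ->
  exists (E : fieldType) (j : {rmorphism K -> E}) (N : nat)
      (s : 'I_N -> {rmorphism L -> E}),
    (forall i k, s i (phi k) = j k) /\
    forall a, exists g : {poly K}, [/\ g \is monic, root (map_poly phi g) a &
      exists r : seq 'I_N, map_poly j g = \prod_(i <- r) ('X - (s i a)%:P)].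
Proof.
move=> b_span; have [m [M M_phi]] := regular_representation b_span.
pose p := \prod_(i < n) mxminpoly (M (b i)).
have p_monic : p \is monic.
  by apply: monic_prod => i _; apply: mxminpoly_monic.
have [E [j [rs pE]]] := splitting_extension p_monic.
have p_dvd (E' : fieldType) (h : {rmorphism E -> E'}) i :
    (map_poly (h \o j) (mxminpoly (M (b i))) %|
      \prod_(z <- [seq h x | x <- rs]) ('X - z%:P))%R.
  have -> : \prod_(z <- [seq h x | x <- rs]) ('X - z%:P) =
      map_poly (h \o j) p.
    rewrite map_poly_comp pE rmorph_prod big_map; apply: eq_bigr => x _.
    by rewrite /= map_polyXsubC.
  by rewrite dvdp_map /p (bigD1 i) //= dvdp_mulr.
(* No extension [E'] of [E] contributes new roots to the minimal polynomial of [M (b i)]. *)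
have b_root (E' : fieldType) (h : {rmorphism E -> E'}) i z :
    root (map_poly (h \o j) (mxminpoly (M (b i)))) z ->
  exists t : 'I_(size rs), z = h rs`_t.
  move=> zi; have [q qE] := dvdpP _ _ (p_dvd E' h i).
  have : z \in [seq h x | x <- rs] by rewrite -root_prod_XsubC qE rootM zi orbT.
  case/mapP=> x /(nthP 0)[t lt_t <-] ->.
  by exists (Ordinal lt_t).
pose X := {s : {rmorphism L -> E} |
  (forall k, s (phi k) = j k) /\
  forall i, exists t : 'I_(size rs), s (b i) = rs`_t}.
have [|N [s sP]] := @finite_representatives X {ffun 'I_n -> 'I_(size rs)}
    (fun s t => forall i, sval s (b i) = rs`_(t i)).
  move=> [s sX]; have [_ /choice[t tE]] := sX.
  by exists [ffun i => t i] => i; rewrite ffunE.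
exists E, j, N, (fun k => sval (s k)); split=> [i k|a].
  by case: (s i) => ? [].
exists (mxminpoly (M a)); split; first exact: mxminpoly_monic.
  (* A ring morphism out of a field is injective, so the minimal polynomial of [M a] vanishes at
     [a]. *)
  have := mx_root_minpoly (M a); rewrite (horner_representation M_phi).
  by rewrite -[RHS](rmorph0 M) => /fmorph_inj/eqP.
(* Each root of the minimal polynomial of M a in an extension E' of E is the
   image of a under an embedding of L in E'; this embedding maps the b i to
   roots that are already in E, hence it lands in E. *)
have [E' [h [ys yE]]] :=
  splitting_extension (monic_map j (mxminpoly_monic (M a))).
have ys_s y : y \in ys -> exists k, y = h (sval (s k) a).
  rewrite -root_prod_XsubC -yE -map_poly_comp.
  case/(embedding_of_root b_span M_phi (p_dvd E' h))=> s' [s'phi <- s'root].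
  have [|s0 s0E] := @factor_through_extension _ _ h s'.
    move=> c; have [k ->] := b_span c.
    have /choice[z zE] i := b_root _ _ _ _ (s'root (b i)).
    exists (\sum_i j (k i) * rs`_(z i)); rewrite !rmorph_sum.
    by apply: eq_bigr => i _; rewrite !rmorphM s'phi zE.
  have s0phi k : s0 (phi k) = j k.
    by apply: (fmorph_inj h); rewrite -s0E s'phi.
  have s0b i : exists t : 'I_(size rs), s0 (b i) = rs`_t.
    have [t tE] := b_root _ _ _ _ (s'root (b i)).
    by exists t; apply: (fmorph_inj h); rewrite -s0E.
  have [k [t [s0t skt]]] := sP (exist _ s0 (conj s0phi s0b)).
  exists k; rewrite s0E; congr (h _); have [d aE] := b_span a; rewrite {}aE.
  case: (s k) skt => sk [skphi _] /= skt; rewrite !rmorph_sum.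
  by apply: eq_bigr => i _; rewrite !rmorphM s0phi skphi skt -s0t.
have [r rE] : exists r, ys = [seq h (sval (s k) a) | k <- r].
  elim: (ys) ys_s => [|y ys' IH] ys_s'; first by exists [::].
  have [k ->] := ys_s' y (mem_head _ _).
  have [z zys|r ->] := IH; first by apply: ys_s'; rewrite inE zys orbT.
  by exists (k :: r).
exists r; apply: (map_poly_inj h); rewrite yE rE big_map rmorph_prod.
by apply: eq_bigr => k _; rewrite /= map_polyXsubC.
Qed.
End Embeddings.

(** * Conjugate primes *)

(** This separates the ideal theory from the field theory: the conjugates enter only through their
    agreement on [R] and the norm-like element [c]. *)
Lemma Spec_chains_of_conjugates (R S T : comNzRingType)
    (f : {rmorphism R -> S}) (F : {rmorphism R -> T}) (N : nat)
    (s : 'I_N -> {rmorphism S -> T}) :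
  integralRange f -> integralRange F -> injective F ->
  (forall i x, s i (f x) = F x) ->
  (forall a : S, exists (c : R) (b : S) (r : seq 'I_N),
    f c = b * a /\ F c = \prod_(i <- r) s i a) ->
  Spec_finite_union_of_chains R -> Spec_finite_union_of_chains S.
Proof.
move=> f_int F_int F_inj sf norm [n [C [C_chain RC]]].
have /choice[D Dlift] i := lift_chain F_int F_inj (C_chain i).
(* There is one chain for each pair of a chain of [R] and an embedding, the pairs being enumerated
   by an ordinal. *)
pose C' (k : 'I_#|{: 'I_n * 'I_N}|) := [set Q | exists2 p,
  C (enum_val k).1 p & Q = s (enum_val k).2 @^-1` D (enum_val k).1 p].
exists _, C'; split=> [k|].
  have [Dover Dmono] := Dlift (enum_val k).1.
  split=> [Q [p Cp ->]|Q Q' [p Cp ->] [p' Cp' ->]].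
    by apply: Spec_preimage; have [] := Dover p Cp.
  have [_ Ctot] := C_chain (enum_val k).1.
  by case: (Ctot p p' Cp Cp') => pp'; [left|right] => x /=; apply: Dmono.
apply/seteqP; split=> [Q QP|Q [k _ [p Cp ->]]]; last first.
  by apply: Spec_preimage; have [/(_ p Cp)[]] := Dlift (enum_val k).1.
have [Q0 _ Qlin _] := (SpecP Q).1 QP.
have pP : Spec (f @^-1` Q) by exact: Spec_preimage.
have [i _ Cp] : (\bigcup_(i : 'I_n) C i) (f @^-1` Q) by rewrite -RC.
have [/(_ _ Cp)[PP FP] _] := Dlift i; set P := D i _ in PP FP.
have [k QE] : exists k, Q = s k @^-1` P.
  apply: contrapT => nex.
  have [k|k _|a Qa aP] :=
    @prime_avoidance _ _ (fun k => s k @^-1` P) (enum 'I_N) Q Q0 Qlin.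
  - exact: (Spec_preimage (s k) PP).
  (* If [Q] were inside the preimage of [P] under [s k], incomparability would make them equal, as
     both contract to the same prime of [R]. *)
  - apply: contrapT => nQk; apply: nex; exists k.
    apply: (incomparability f_int) => //; first exact: (Spec_preimage (s k) PP).
      by move=> x Qx; apply: contrapT => nPx; apply: nQk; exists x.
    rewrite -FP; apply/seteqP.
    by split=> x /=; rewrite sf.
  have [c [b [r [fc Fc]]]] := norm a.
  have : (f @^-1` Q) c by rewrite /= fc; apply: idealM.
  rewrite -FP /= Fc => /(prime_prod PP)[k Pk].
  by apply: (aP k) => //; rewrite mem_enum.
exists (enum_rank (i, k)) => //.
by exists (f @^-1` Q); rewrite enum_rankK.
Qed.

(** * The integral closure of [R] in [E], and the theorem *)

Section IntegralClosure.
Variables (R : comNzRingType) (E : fieldType) (g : {rmorphism R -> E}).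

Definition integral_elem : pred E := fun x => `[< integralOver g x >].

Lemma integral_elem_subring : subring_closed integral_elem.
Proof.
split=> [|x y|x y]; rewrite ?unfold_in; first exact/asboolP/integral1.
  by move=> /asboolP gx /asboolP gy; apply/asboolP/integral_sub.
by move=> /asboolP gx /asboolP gy; apply/asboolP/integral_mul.
Qed.

HB.instance Definition _ :=
  GRing.isSubringClosed.Build E integral_elem integral_elem_subring.

Definition integral_closure := {x : E | integral_elem x}.
HB.instance Definition _ := Choice.on integral_closure.
HB.instance Definition _ := SubChoice.on integral_closure.
HB.instance Definition _ :=
  [SubChoice_isSubComNzRing of integral_closure by <:].

Lemma corestrict_integral_closure (B : comNzRingType) (h : {rmorphism B -> E}) :
  (forall x, integralOver g (h x)) ->
  exists h' : {rmorphism B -> integral_closure}, forall x, val (h' x) = h x.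
Proof.
move=> h_int; pose h' x : integral_closure := Sub (h x) (asboolT (h_int x)).
have h'B : zmod_morphism h'.
  by move=> x y; apply: val_inj; rewrite rmorphB /= rmorphB.
have h'M : monoid_morphism h'.
  split=> [|x y]; apply: val_inj; first by rewrite rmorph1 /= rmorph1.
  by rewrite rmorphM /= rmorphM.
pose hBm := GRing.isZmodMorphism.Build _ _ h' h'B.
pose hMm := GRing.isMonoidMorphism.Build _ _ h' h'M.
pose hR : {rmorphism B -> integral_closure} := HB.pack h' hBm hMm.
by exists hR.
Qed.

Lemma integral_closure_integral (F : {rmorphism R -> integral_closure}) :
  (forall x, val (F x) = g x) -> integralRange F.
Proof.
move=> FE t; have /asboolP[p p_monic pt] := valP t; exists p => //.
apply/eqP/val_inj; rewrite rmorph0 -horner_map -map_poly_comp.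
by rewrite (eq_map_poly FE); apply/eqP.
Qed.

End IntegralClosure.

Lemma horner_coef0_mod (S : comNzRingType) (p : {poly S}) x :
  exists b, p.[x] = b * x + p`_0.
Proof.
elim/poly_ind: p => [|p c _].
  by exists 0; rewrite horner0 mul0r coef0 addr0.
by exists p.[x]; rewrite hornerMXaddC coefD coefMX coefC /= add0r.
Qed.

(** Multiplying by one more factor forms the new coefficients from the old ones and the root by
    products and differences, which preserve integrality. *)
Lemma integral_coef_prod_XsubC (R K : comNzRingType) (g : {rmorphism R -> K})
    (I : Type) (r : seq I) (z : I -> K) :
  (forall i, integralOver g (z i)) ->
  forall k, integralOver g (\prod_(i <- r) ('X - (z i)%:P))`_k.
Proof.
move=> z_int; elim: r => [|i r IHr] k.
  by rewrite big_nil coef1; apply: integral_nat.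
rewrite big_cons mulrBl coefB coefXM coefCM; apply: integral_sub.
  by case: eqP => _ //; apply: integral0.
exact: integral_mul.
Qed.

Theorem theorem5p1 (R S : idomainType) (f : {rmorphism R -> S})
    (f_inj : injective f)
    (f_integral : integralRange f)
    (f_finite : frac_finite f)
    (R_closed : integrally_closed R)
    (R_chains : Spec_finite_union_of_chains R) :
  Spec_finite_union_of_chains S.
Proof.
pose phiB := GRing.isZmodMorphism.Build _ _ _ (frac_map_is_zmod_morphism f_inj).
pose phiM := GRing.isMonoidMorphism.Build _ _ _
  (frac_map_is_monoid_morphism f_inj).
pose phi : {rmorphism {fraction R} -> {fraction S}} :=
  HB.pack (frac_map f) phiB phiM.
have phi_tofrac x : phi (FracField.tofrac x) = FracField.tofrac (f x).
  exact: frac_map_tofrac.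
have [n [b b_span]] := f_finite.
have [E [j [N [s [s_phi conj]]]]] := @finite_embeddings _ _ phi n b b_span.
pose g : {rmorphism R -> E} := j \o @FracField.tofrac R.
have s_int i x : integralOver g ((s i \o @FracField.tofrac S) x).
  have := integral_rmorph (s i \o @FracField.tofrac S) (f_integral x).
  congr integralOver; apply: funext => y /=.
  by rewrite -phi_tofrac s_phi.
have [F FE] := corestrict_integral_closure (@integral_id _ _ g).
have /choice[t tE] i := corestrict_integral_closure (s_int i).
apply: (@Spec_chains_of_conjugates _ _ (integral_closure g) f F N t) R_chains
  => //.
- exact: integral_closure_integral.
- move=> x y /(congr1 val); rewrite !FE => /fmorph_inj/eqP.
  by rewrite tofrac_eq => /eqP.
- by move=> i x; apply: val_inj; rewrite tE FE /= -phi_tofrac s_phi.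
(* Taking [- a] instead of [a] absorbs the sign: the constant term of the product of the factors
   ['X - s i (- a)] is exactly the product of the [s i a]. *)
move=> a; have [p [p_monic pa [r pE]]] := conj (FracField.tofrac (- a)).
have /choice[c cE] k : exists x, p`_k = FracField.tofrac x.
  apply: R_closed.
  have : integralOver g (j p`_k).
    rewrite -coef_map pE; apply: integral_coef_prod_XsubC => i.
    exact: s_int.
  (* Since [j] is a field morphism, the integral equation of [j p]_k[already holds for]p[_k] in the
     fraction field of [R]. *)
  case=> q q_monic; rewrite map_poly_comp fmorph_root => qk.
  by exists q.
pose p0 := \poly_(k < size p) c k.
have p0E : p = map_poly (@FracField.tofrac R) p0.
  apply/polyP => k; rewrite coef_map coef_poly; case: ltnP => // le_pk.
  by rewrite nth_default // rmorph0.
have p0a : (map_poly f p0).[- a] = 0.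
  apply/eqP; rewrite -tofrac_eq0 -horner_map -map_poly_comp.
  move: pa; rewrite p0E -map_poly_comp.
  by rewrite (eq_map_poly phi_tofrac).
have [d] := horner_coef0_mod (map_poly f p0) (- a).
rewrite p0a coef_map => /eqP.
rewrite eq_sym addrC addr_eq0 mulrN opprK => /eqP fc.
exists (p0`_0), d, r; split=> //; apply: val_inj.
rewrite FE rmorph_prod /= -coef_map -p0E -coef_map -horner_coef0 pE.
rewrite horner_prod; apply: eq_bigr => i _.
by rewrite tE hornerXsubC sub0r /= !rmorphN opprK.
Qed.
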